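(* Let $X$ be an $e^*\theta$-normal topological space, $Y$ a topological space, and $f:X\to Y$ a continuous surjection that is pre $e^*\theta$-open and almost $e^*\theta$-irresolute. Then $Y$ is $e^*\theta$-normal.
   Context: For a subset $A$ of a topological space $X$, $cl(A)$ and $int(A)$ denote closure and interior. The $\delta$-closure $cl_\delta(A)$ is the set of points $x\in X$ such that $int(cl(U))\cap A\neq\emptyset$ for every open $U$ containing $x$. $A$ is $e^*$-open if $A\subseteq cl(int(cl_\delta(A)))$; complements of $e^*$-open sets are $e^*$-closed; $e^*\text{-}cl(A)$ is the intersection of all $e^*$-closed sets containing $A$. The $e^*$-$\theta$-closure $e^*\text{-}cl_\theta(A)$ is the set of points $x\in X$ such that $e^*\text{-}cl(U)\cap A\neq\emptyset$ for every $e^*$-open set $U$ containing $x$. $A$ is $e^*$-$\theta$-closed if $A=e^*\text{-}cl_\theta(A)$; complements of $e^*$-$\theta$-closed sets are called $e^*$-$\theta$-open. A function $f:X\to Y$ is pre $e^*\theta$-open if the image of each $e^*$-$\theta$-open set of $X$ is $e^*$-$\theta$-open in $Y$. It is almost $e^*\theta$-irresolute if $f[e^*\text{-}cl_\theta(U)]=e^*\text{-}cl_\theta(f[U])$ for every $e^*$-$\theta$-open set $U$ of $X$. A space is $e^*\theta$-normal if for any pair of disjoint closed sets $F_1$ and $F_2$ there exist disjoint $e^*$-$\theta$-open sets $U_1$ and $U_2$ with $F_1\subseteq U_1$ and $F_2\subseteq U_2$. *)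

(* Defs.v *)
From HB Require Import structures.
From mathcomp Require Import all_boot all_order.
From mathcomp Require Import boolp classical_sets functions topology.

Set Implicit Arguments.
Unset Strict Implicit.
Unset Printing Implicit Defensive.

Local Open Scope classical_set_scope.

(* The library's [topologicalType] is not pointed, so the empty space is
   allowed, and no separation axiom is assumed. *)

Section EstarTheta.
Context {X : topologicalType}.
Implicit Types A U C : set X.

Definition delta_closure A : set X :=
  [set x | forall U, open U -> U x -> interior (closure U) `&` A !=set0].

Definition estar_open A : Prop :=
  A `<=` closure (interior (delta_closure A)).

Definition estar_closed A : Prop := estar_open (~` A).

Definition estar_closure A : set X :=
  \bigcap_(C in [set C | estar_closed C /\ A `<=` C]) C.

Definition estar_theta_closure A : set X :=
  [set x | forall U, estar_open U -> U x -> estar_closure U `&` A !=set0].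

Definition estar_theta_closed A : Prop := A = estar_theta_closure A.

Definition estar_theta_open A : Prop := estar_theta_closed (~` A).

End EstarTheta.

Definition estar_theta_normal (X : topologicalType) : Prop :=
  forall F1 F2 : set X, closed F1 -> closed F2 -> F1 `&` F2 = set0 ->
    exists U1 U2 : set X,
      [/\ estar_theta_open U1, estar_theta_open U2, U1 `&` U2 = set0,
          F1 `<=` U1 & F2 `<=` U2].

Definition pre_estar_theta_open (X Y : topologicalType) (f : X -> Y) : Prop :=
  forall U : set X, estar_theta_open U -> estar_theta_open (f @` U).

Definition almost_estar_theta_irresolute (X Y : topologicalType)
    (f : X -> Y) : Prop :=
  forall U : set X, estar_theta_open U ->
    f @` estar_theta_closure U = estar_theta_closure (f @` U).

(* Main.v *)
(* Normality of X separates the preimages of disjoint closed sets F1, F2 by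
   e*-theta-open sets U1, U2.  The images of U1 and U2 may meet, so F2 is instead
   separated from F1 by the complement of e*-cl_theta(f[U1]) = f[e*-cl_theta(U1)]:
   e*-cl_theta(U1) misses U2, which contains the whole fibre over every point of F2.
   That complement is e*-theta-open because e*-cl_theta is idempotent, which comes
   from the fact that the e*-closure of an e*-open set is again e*-open. *)
Require Import Defs.
From mathcomp Require Import all_boot all_order.
From mathcomp Require Import boolp classical_sets functions topology.

Local Open Scope classical_set_scope.

Section EstarThetaClosure.
Context {X : topologicalType}.
Implicit Types A B U : set X.

Lemma subset_delta_closure A : A `<=` delta_closure A.
Proof.
move=> x Ax U oU Ux; exists x; split => //.
by apply: (interiorS (@subset_closure _ U)); exact: open_nbhs_nbhs.
Qed.

Lemma delta_closureS A B : A `<=` B -> delta_closure A `<=` delta_closure B.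
Proof. by move=> AB x Ax U oU Ux; apply: subset_nonempty (Ax U oU Ux); apply: setIS. Qed.

Lemma open_estar_open U : open U -> estar_open U.
Proof.
move=> oU x Ux; apply: subset_closure.
by apply: (interiorS (@subset_delta_closure U)); exact: open_nbhs_nbhs.
Qed.

(** Lets closed sets serve as members of the intersection defining [estar_closure]. *)
Lemma closed_estar_closed A : closed A -> estar_closed A.
Proof. by move=> cA; apply: open_estar_open; exact: closed_openC. Qed.

Lemma subset_estar_closure A : A `<=` estar_closure A.
Proof. by move=> x Ax C [_]; apply. Qed.

Lemma estar_closure_idem A : estar_closure (estar_closure A) = estar_closure A.
Proof.
apply/seteqP; split; last exact: subset_estar_closure.
by move=> x clx C [cC AC]; apply: clx; split=> // y; apply.
Qed.

(* [cl(int(cl_delta(U)))] is closed, hence e*-closed, so it contains [e*-cl(U)]. *)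
Lemma estar_open_closure U : estar_open U -> estar_open (estar_closure U).
Proof.
move=> oU x clx.
have: closure (interior (delta_closure U)) x.
  by apply: clx; split=> //; apply: closed_estar_closed; exact: closed_closure.
apply: closureS; apply: interiorS; apply: delta_closureS.
exact: subset_estar_closure.
Qed.

Lemma subset_estar_theta_closure A : A `<=` estar_theta_closure A.
Proof. by move=> x Ax U _ Ux; exists x; split=> //; exact: subset_estar_closure. Qed.

Lemma estar_theta_closureS A B :
  A `<=` B -> estar_theta_closure A `<=` estar_theta_closure B.
Proof. by move=> AB x Ax U oU Ux; apply: subset_nonempty (Ax U oU Ux); apply: setIS. Qed.

(** If [y] lies in both [estar_closure U] and [estar_theta_closure A], then [estar_closure U] is
    itself an e*-open set around [y] and equals its own e*-closure, so it meets [A]. *)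
Lemma estar_theta_closed_closure A : estar_theta_closed (estar_theta_closure A).
Proof.
apply/seteqP; split; first exact: subset_estar_theta_closure.
move=> x clx U oU Ux; have [y [Uy Ay]] := clx U oU Ux.
by rewrite -estar_closure_idem; apply: Ay => //; exact: estar_open_closure.
Qed.

(** The complement of [U] is its own e*-theta-closure, so monotonicity suffices. *)
Lemma estar_theta_closure_disjoint A U :
  estar_theta_open U -> A `&` U = set0 -> estar_theta_closure A `&` U = set0.
Proof.
by move=> oU /disjoints_subset AU; apply/disjoints_subset; rewrite oU;
  exact: estar_theta_closureS.
Qed.

End EstarThetaClosure.

Theorem theorem8 (X Y : topologicalType) (f : X -> Y)
    (X_normal : estar_theta_normal X)
    (f_continuous : continuous f)
    (f_surj : set_surj [set: X] [set: Y] f)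
    (f_pre_open : pre_estar_theta_open f)
    (f_irresolute : almost_estar_theta_irresolute f) :
  estar_theta_normal Y.
Proof.
move=> F1 F2 cF1 cF2 F12.
have cpre F : closed F -> closed (f @^-1` F) by apply: preimage_closed.
have pre12 : f @^-1` F1 `&` f @^-1` F2 = set0.
  by rewrite -preimage_setI F12 preimage_set0.
have [U1 [U2 [oU1 oU2 U12 FU1 FU2]]] := X_normal _ _ (cpre _ cF1) (cpre _ cF2) pre12.
exists (f @` U1), (~` estar_theta_closure (f @` U1)); split.
- exact: f_pre_open.
- by rewrite /estar_theta_open setCK; exact: estar_theta_closed_closure.
- by apply/disjoints_subset; rewrite setCK; exact: subset_estar_theta_closure.
- move=> y F1y; have [x _ fxy] := f_surj y I.
  by exists x => //; apply: FU1; rewrite /preimage /= fxy.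
(* Irresoluteness lifts [y] to a point [x] of [estar_theta_closure U1]; lying over [F2], it is also
   in [U2]. *)
- move=> y F2y; rewrite -f_irresolute // => -[x clx fxy].
  have /disjoints_subset U2x := estar_theta_closure_disjoint _ _ oU2 U12.
  by apply: (U2x x clx); apply: FU2; rewrite /preimage /= fxy.
Qed.
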